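(* Let $(A,\cdot)$ be a unital associative algebra over a field $K$ and let $*$ be an associative product on $A$. Then the following are equivalent: (i) $*$ is $(12)$-matching with $\cdot$; (ii) $*$ is interchangeable with $\cdot$; (iii) $*$ is totally compatible with $\cdot$; (iv) $*$ is determined by an element of $\Gamma(A)\cong C(A)$, i.e. there exists $\varphi\in\Gamma(A)$ such that $a*b=\varphi(a\cdot b)$ for all $a,b\in A$.
   Context: All algebras and vector spaces are over a field $K$ and all products are binary and bilinear. Let $(A,\cdot)$ be an associative algebra and $*$ an associative product on $A$. - $*$ is $(12)$-matching with $\cdot$ if $(a*b)\cdot c=a\cdot(b*c)$ and $(a\cdot b)*c=a*(b\cdot c)$ for all $a,b,c\in A$. - $*$ is interchangeable with $\cdot$ if $(a*b)\cdot c=(a\cdot b)*c$ and $a*(b\cdot c)=a\cdot(b*c)$ for all $a,b,c\in A$. - $*$ is totally compatible with $\cdot$ if $(a*b)\cdot c=(a\cdot b)*c=a*(b\cdot c)=a\cdot(b*c)$ for all $a,b,c\in A$. The centroid $\Gamma(A)$ is the space of linear maps $\varphi:A\to A$ with $x\cdot\varphi(y)=\varphi(x\cdot y)=\varphi(x)\cdot y$ for all $x,y\in A$. A product $*$ is determined by $\varphi\in\Gamma(A)$ if $a*b=\varphi(a\cdot b)$ for all $a,b\in A$. $C(A)$ denotes the center of $A$; for unital $A$ the isomorphism $C(A)\cong\Gamma(A)$ of $K$-spaces sends $c\in C(A)$ to the map $a\mapsto c\cdot a$, with inverse $\varphi\mapsto\varphi(1)$. *)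

(* Defs.v *)
From mathcomp Require Import all_boot all_order all_algebra.

Set Implicit Arguments.
Unset Strict Implicit.
Unset Printing Implicit Defensive.

Import GRing.Theory.
Local Open Scope ring_scope.

(* An algebra over K is a K-module A together with a product
   [dot : {bilinear A -> A -> A}], so that several products on the same space
   can be compared.  Unlike [algType K], this does not exclude the zero
   algebra. *)

Section Compatibility.

Variables (K : fieldType) (A : lmodType K).
Implicit Types (dot star : {bilinear A -> A -> A}) (phi : {linear A -> A}).

Definition unit_of dot (e : A) : Prop := left_id e dot /\ right_id e dot.

Definition matching12 dot star : Prop :=
  forall a b c : A,
    dot (star a b) c = dot a (star b c) /\
    star (dot a b) c = star a (dot b c).

Definition interchangeable dot star : Prop :=
  forall a b c : A,
    dot (star a b) c = star (dot a b) c /\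
    star a (dot b c) = dot a (star b c).

Definition totally_compatible dot star : Prop :=
  forall a b c : A,
    [/\ dot (star a b) c = star (dot a b) c,
        star (dot a b) c = star a (dot b c)
      & star a (dot b c) = dot a (star b c)].

Definition in_centroid dot phi : Prop :=
  forall x y : A,
    dot x (phi y) = phi (dot x y) /\ phi (dot x y) = dot (phi x) y.

Definition determined_by dot star phi : Prop :=
  forall a b : A, star a b = phi (dot a b).

Definition in_center dot (c : A) : Prop := forall x : A, dot c x = dot x c.

(* The maps [c |-> dot c] and [phi |-> phi e] are mutually inverse K-linear
   bijections between C(A) and Gamma(A); elements of Gamma(A) are compared
   pointwise, since Leibniz equality on [{linear A -> A}] is intensional. *)
Definition center_centroid_iso dot (e : A) : Prop :=
  [/\ forall c : A, in_center dot c -> in_centroid dot (dot c),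
      forall phi, in_centroid dot phi -> in_center dot (phi e),
      forall c : A, in_center dot c -> dot c e = c,
      forall phi, in_centroid dot phi -> dot (phi e) =1 phi
    & forall (k : K) (c d : A), in_center dot c -> in_center dot d ->
        dot (k *: c + d) =1 (k \*: dot c) \+ dot d].

End Compatibility.

(* Main.v *)
Require Import Defs.
From mathcomp Require Import all_boot all_order all_algebra.

(** Everything is controlled by the single element [u = star e e].  Placing
    the unit [e] in suitable slots of either the matching or the interchange
    laws gives [star a b = dot (star e a) b] and
    [dot u a = star e a = star a e = dot a u].  Thus [u] is central and
    [star a b = dot u (dot a b)] ([matching12_central],
    [interchangeable_central]); multiplication by a central element belongs to
    the centroid ([central_in_centroid]), so [star] is determined by it.
    Conversely, a centroid map moves freely across the factors of a product, so
    if [star a b = phi (dot a b)] then all four mixed products of [a], [b], [c]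
    equal [phi (dot (dot a b) c)] ([determined_totally_compatible]).  The
    matching and the interchange laws are equalities between these products. *)

Set Implicit Arguments.
Unset Strict Implicit.
Unset Printing Implicit Defensive.

Import GRing.Theory.
Local Open Scope ring_scope.

Section UnitalCompatibility.

Variables (K : fieldType) (A : lmodType K) (dot : {bilinear A -> A -> A}).
Hypothesis dot_assoc : associative dot.
Implicit Types (star : {bilinear A -> A -> A}) (phi : {linear A -> A}).

Lemma central_in_centroid (c : A) : in_center dot c -> in_centroid dot (dot c).
Proof. by move=> cC x y; rewrite /= !dot_assoc cC. Qed.

Lemma determined_totally_compatible star phi :
  in_centroid dot phi -> determined_by dot star phi ->
  totally_compatible dot star.
Proof.
move=> phiC starE a b c.
have phil x y : dot (phi x) y = phi (dot x y) by case: (phiC x y).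
have phir x y : dot x (phi y) = phi (dot x y) by case: (phiC x y).
by split; rewrite !starE ?phil ?phir ?dot_assoc.
Qed.

Variable e : A.
Hypothesis dot_unit : unit_of dot e.

Let dot1l : left_id e dot. Proof. by case: dot_unit. Qed.
Let dot1r : right_id e dot. Proof. by case: dot_unit. Qed.

(** For [phi] in the centroid, [dot (phi e) x] and [dot x (phi e)] are both
    [phi x], as [phi] can be pulled out of either factor; this gives both that
    [phi e] is central and that it recovers [phi]. *)
Lemma unital_center_centroid_iso : center_centroid_iso dot e.
Proof.
split=> [c|phi phiC x|c _|phi phiC x|k c d _ _ x].
- exact: central_in_centroid.
- have [_ <-] := phiC e x; have [-> _] := phiC x e.
  by rewrite dot1l dot1r.
- exact: dot1r.
- by have [_ <-] := phiC e x; rewrite dot1l.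
- by rewrite linearPl.
Qed.

(** Matching moves [star] from one gap of a triple product to the other.  With
    [e] as the last or the first factor it therefore shifts [star a b] right,
    onto [star b e], or left, onto [star e a]; the two shifts meet when one of
    [a], [b] is [e]. *)
Lemma matching12_central star : matching12 dot star ->
  in_center dot (star e e) /\ determined_by dot star (dot (star e e)).
Proof.
move=> starM.
have starr a b : star a b = dot a (star b e).
  by have [<- _] := starM a b e; rewrite dot1r.
have starl a b : star a b = dot (star e a) b.
  by have [-> _] := starM e a b; rewrite dot1l.
have uC : in_center dot (star e e).
  by move=> x; rewrite -starl -starr starr dot1l.
by split=> // a b; rewrite /= starl (starl e a) dot_assoc.
Qed.

(** Interchanging swaps [star] and [dot] while keeping the brackets.  The
    factor [e] therefore turns a [dot] by the unit, which is invisible, into a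
    [star] by the unit; [star a e], computed by both laws, links the two sides
    of [star e e]. *)
Lemma interchangeable_central star : interchangeable dot star ->
  in_center dot (star e e) /\ determined_by dot star (dot (star e e)).
Proof.
move=> starI.
have starl a b : star a b = dot (star e a) b.
  by have [-> _] := starI e a b; rewrite dot1l.
have starer a : star a e = dot a (star e e).
  by have [_ <-] := starI a e e; rewrite dot1l.
have uC : in_center dot (star e e).
  by move=> x; rewrite -starl -starer (starl x e) dot1r.
by split=> // a b; rewrite /= starl (starl e a) dot_assoc.
Qed.

End UnitalCompatibility.

Theorem proposition2p6 (K : fieldType) (A : lmodType K)
    (dot : {bilinear A -> A -> A}) (e : A)
    (dot_assoc : associative dot) (dot_unit : unit_of dot e)
    (star : {bilinear A -> A -> A}) (star_assoc : associative star) :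
  center_centroid_iso dot e /\
  [<-> matching12 dot star;
       interchangeable dot star;
       totally_compatible dot star;
       exists phi : {linear A -> A},
         in_centroid dot phi /\ determined_by dot star phi].
Proof.
split; first exact: unital_center_centroid_iso.
tfae.
- move=> /(matching12_central dot_assoc dot_unit)[uC starE] a b c.
  have uG := central_in_centroid dot_assoc uC.
  by have [-> -> ->] := determined_totally_compatible dot_assoc uG starE a b c.
- move=> /(interchangeable_central dot_assoc dot_unit)[uC starE].
  have uG := central_in_centroid dot_assoc uC.
  exact: (determined_totally_compatible dot_assoc uG starE).
- move=> starT; have starI : interchangeable dot star.
    by move=> a b c; have [-> _ ->] := starT a b c.
  have [uC starE] := interchangeable_central dot_assoc dot_unit starI.
  exists (dot (star e e)); split=> //.
  exact: central_in_centroid.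
- move=> [phi [phiG starE]] a b c.
  by have [-> -> ->] := determined_totally_compatible dot_assoc phiG starE a b c.
Qed.
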